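(* Let $m\colon I\to\Theta$, $f\colon\Theta\to X$ and $g\colon\Theta\to Y$ be morphisms in a Markov category $\mathsf{C}$. If $\mathsf{C}$ has conditionals, then the following are equivalent: (i) $f$ is $m$-a.s. more informative than $g$, i.e. there is a morphism $c\colon X\to Y$ with $c\circ f=_{m\text{-a.s.}}g$. (ii) There exists a morphism $h\colon\Theta\to X\otimes Y$ whose marginals are $m$-a.s. given by $f$ and $g$, i.e. $(\mathrm{id}_X\otimes\mathrm{del}_Y)\circ h=_{m\text{-a.s.}}f$ and $(\mathrm{del}_X\otimes\mathrm{id}_Y)\circ h=_{m\text{-a.s.}}g$, such that the deterministic morphism $\mathrm{id}_X\otimes\mathrm{del}_Y\colon X\otimes Y\to X$ is a sufficient statistic for $h$. (iii) There exists a morphism $\mu\colon I\to\Theta\otimes X\otimes Y$ satisfying (a) the $\Theta$-marginal of $\mu$ is $m$, i.e. $(\mathrm{id}_\Theta\otimes\mathrm{del}_X\otimes\mathrm{del}_Y)\circ\mu=m$; (b) $\mu$ displays the conditional independence of $\Theta$ and $Y$ given $X$, i.e. there are morphisms $n\colon I\to X$, $k\colon X\to\Theta$ and $c\colon X\to Y$ with $\mu=(k\otimes\mathrm{id}_X\otimes c)\circ(\mathrm{copy}_X\otimes\mathrm{id}_X)\circ\mathrm{copy}_X\circ n$; (c) $\mu_{X|\Theta}=_{m\text{-a.s.}}f$; (d) $\mu_{Y|\Theta}=_{m\text{-a.s.}}g$; where $\mu_{X|\Theta}\colon\Theta\to X$ and $\mu_{Y|\Theta}\colon\Theta\to Y$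 denote conditionals with respect to $\Theta$ of the marginals $(\mathrm{id}_\Theta\otimes\mathrm{id}_X\otimes\mathrm{del}_Y)\circ\mu$ and $(\mathrm{id}_\Theta\otimes\mathrm{del}_X\otimes\mathrm{id}_Y)\circ\mu$.
   Context: Coherence isomorphisms of monoidal categories are suppressed. A Markov category is a symmetric monoidal category $(\mathsf{C},\otimes,I)$ whose unit $I$ is terminal (write $\mathrm{del}_X \colon X \to I$), in which every object $X$ carries a distinguished morphism $\mathrm{copy}_X \colon X \to X\otimes X$ making $(X,\mathrm{copy}_X,\mathrm{del}_X)$ a commutative comonoid, and such that $\mathrm{copy}_{X\otimes Y} = (\mathrm{id}_X\otimes \mathrm{swap}_{X,Y}\otimes \mathrm{id}_Y)\circ(\mathrm{copy}_X\otimes \mathrm{copy}_Y)$. A morphism $f\colon X\to Y$ is deterministic if $\mathrm{copy}_Y\circ f=(f\otimes f)\circ \mathrm{copy}_X$. Conditionals: a conditional of $f\colon A\to X\otimes Y$ with respect to $X$ is a morphism $f_{|X}\colon X\otimes A\to Y$ with $f=(\mathrm{id}_X\otimes f_{|X})\circ(\mathrm{copy}_X\otimes \mathrm{id}_A)\circ(((\mathrm{id}_X\otimes \mathrm{del}_Y)\circ f)\otimes \mathrm{id}_A)\circ \mathrm{copy}_A$. $\mathsf{C}$ has conditionals if these exist for all such $f$. Almost sure equality: for $h\colon A\to X$ and $f,g\colon X\to Y$, write $f=_{h\text{-a.s.}}g$ if $(\mathrm{id}_X\otimes f)\circ \mathrm{copy}_X\circ h=(\mathrm{id}_X\otimes g)\circ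 \mathrm{copy}_X\circ h$. Conditionals of a morphism out of $I$ are unique up to almost sure equality, so conditions (c) and (d) do not depend on the choice of conditionals. Sufficiency: $\mathrm{id}_X\otimes\mathrm{del}_Y$ is a sufficient statistic for $h\colon\Theta\to X\otimes Y$ if there is a morphism $\alpha\colon X\to X\otimes Y$ with $$(\mathrm{copy}_X\otimes\mathrm{id}_Y)\circ h=(\mathrm{id}_X\otimes\alpha)\circ\mathrm{copy}_X\circ(\mathrm{id}_X\otimes\mathrm{del}_Y)\circ h.$$ *)

(* Defs.v *)
Set Implicit Arguments.
Unset Strict Implicit.
Unset Printing Implicit Defensive.

Record category := Category {
  obj :> Type;
  hom : obj -> obj -> Type;
  idm : forall A : obj, hom A A;
  comp : forall A B D : obj, hom B D -> hom A B -> hom A D;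
  comp_idl : forall (A B : obj) (f : hom A B), comp (idm B) f = f;
  comp_idr : forall (A B : obj) (f : hom A B), comp f (idm A) = f;
  comp_assoc : forall (A B D E : obj) (f : hom D E) (g : hom B D) (h : hom A B),
    comp f (comp g h) = comp (comp f g) h
}.

Declare Scope markov_scope.
Delimit Scope markov_scope with markov.
Local Open Scope markov_scope.

Notation "g ∘ f" := (comp g f) (at level 40, left associativity) : markov_scope.

Arguments hom {c} A B.
Arguments idm {c} A.

(* Not assumed strict: the coherence isomorphisms, left implicit in informal
   string notation, are written out everywhere below.  By symmetry, one of the
   two hexagons is enough. *)
Record symMonCategory := SymMonCategory {
  sm_cat :> category;
  tens : sm_cat -> sm_cat -> sm_cat;
  munit : sm_cat;
  tensm : forall A A' B B' : sm_cat,
    hom A A' -> hom B B' -> hom (tens A B) (tens A' B');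
  tensm_id : forall A B : sm_cat, tensm (idm A) (idm B) = idm (tens A B);
  tensm_comp : forall (A A' A'' B B' B'' : sm_cat)
      (f' : hom A' A'') (f : hom A A') (g' : hom B' B'') (g : hom B B'),
    tensm (f' ∘ f) (g' ∘ g) = tensm f' g' ∘ tensm f g;

  assoc : forall A B D : sm_cat, hom (tens (tens A B) D) (tens A (tens B D));
  associ : forall A B D : sm_cat, hom (tens A (tens B D)) (tens (tens A B) D);
  assocK : forall A B D : sm_cat, associ A B D ∘ assoc A B D = idm _;
  associK : forall A B D : sm_cat, assoc A B D ∘ associ A B D = idm _;
  assoc_nat : forall (A A' B B' D D' : sm_cat)
      (f : hom A A') (g : hom B B') (h : hom D D'),
    assoc A' B' D' ∘ tensm (tensm f g) h = tensm f (tensm g h) ∘ assoc A B D;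

  lunit : forall A : sm_cat, hom (tens munit A) A;
  luniti : forall A : sm_cat, hom A (tens munit A);
  lunitK : forall A : sm_cat, luniti A ∘ lunit A = idm _;
  lunitiK : forall A : sm_cat, lunit A ∘ luniti A = idm _;
  lunit_nat : forall (A A' : sm_cat) (f : hom A A'),
    lunit A' ∘ tensm (idm munit) f = f ∘ lunit A;

  runit : forall A : sm_cat, hom (tens A munit) A;
  runiti : forall A : sm_cat, hom A (tens A munit);
  runitK : forall A : sm_cat, runiti A ∘ runit A = idm _;
  runitiK : forall A : sm_cat, runit A ∘ runiti A = idm _;
  runit_nat : forall (A A' : sm_cat) (f : hom A A'),
    runit A' ∘ tensm f (idm munit) = f ∘ runit A;

  swap : forall A B : sm_cat, hom (tens A B) (tens B A);
  swapK : forall A B : sm_cat, swap B A ∘ swap A B = idm _;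
  swap_nat : forall (A A' B B' : sm_cat) (f : hom A A') (g : hom B B'),
    swap A' B' ∘ tensm f g = tensm g f ∘ swap A B;

  triangle : forall A B : sm_cat,
    tensm (idm A) (lunit B) ∘ assoc A munit B = tensm (runit A) (idm B);
  pentagon : forall A B D E : sm_cat,
    assoc A B (tens D E) ∘ assoc (tens A B) D E
    = tensm (idm A) (assoc B D E) ∘ assoc A (tens B D) E
      ∘ tensm (assoc A B D) (idm E);
  hexagon : forall A B D : sm_cat,
    assoc B D A ∘ swap A (tens B D) ∘ assoc A B D
    = tensm (idm B) (swap A D) ∘ assoc B A D ∘ tensm (swap A B) (idm D)
}.

Notation "A ⊗ B" := (tens A B) (at level 35, right associativity) : markov_scope.
Notation "f ⊗₁ g" := (tensm f g) (at level 35, right associativity) : markov_scope.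

Arguments munit {s}.
Arguments assoc {s} A B D.
Arguments associ {s} A B D.
Arguments lunit {s} A.
Arguments luniti {s} A.
Arguments runit {s} A.
Arguments runiti {s} A.
Arguments swap {s} A B.

(* id_A ⊗ swap_{B,D} ⊗ id_E *)
Definition middle_swap (C : symMonCategory) (A B D E : C) :
    hom ((A ⊗ B) ⊗ (D ⊗ E)) ((A ⊗ D) ⊗ (B ⊗ E)) :=
  associ A D (B ⊗ E)
  ∘ (idm A ⊗₁ (assoc D B E ∘ (swap B D ⊗₁ idm E) ∘ associ B D E))
  ∘ assoc A B (D ⊗ E).

Arguments middle_swap {C} A B D E.

Record markovCategory := MarkovCategory {
  mk_cat :> symMonCategory;
  del : forall X : mk_cat, hom X munit;
  del_unique : forall (X : mk_cat) (f : hom X munit), f = del X;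
  copy : forall X : mk_cat, hom X (X ⊗ X);
  copy_counitl : forall X : mk_cat,
    lunit X ∘ (del X ⊗₁ idm X) ∘ copy X = idm X;
  copy_counitr : forall X : mk_cat,
    runit X ∘ (idm X ⊗₁ del X) ∘ copy X = idm X;
  copy_coassoc : forall X : mk_cat,
    assoc X X X ∘ (copy X ⊗₁ idm X) ∘ copy X = (idm X ⊗₁ copy X) ∘ copy X;
  copy_comm : forall X : mk_cat, swap X X ∘ copy X = copy X;
  copy_tens : forall X Y : mk_cat,
    copy (X ⊗ Y) = middle_swap X X Y Y ∘ (copy X ⊗₁ copy Y)
}.

Arguments del {m} X.
Arguments copy {m} X.

Section Notions.
Variable C : markovCategory.
Implicit Types A X Y Theta : C.

(* id_X ⊗ del_Y and del_X ⊗ id_Y *)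
Definition fstm X Y : hom (X ⊗ Y) X := runit X ∘ (idm X ⊗₁ del Y).
Definition sndm X Y : hom (X ⊗ Y) Y := lunit Y ∘ (del X ⊗₁ idm Y).

Definition deterministic X Y (f : hom X Y) : Prop :=
  copy Y ∘ f = (f ⊗₁ f) ∘ copy X.

Definition is_conditional A X Y (f : hom A (X ⊗ Y)) (p : hom (X ⊗ A) Y) : Prop :=
  f = (idm X ⊗₁ p) ∘ assoc X X A ∘ (copy X ⊗₁ idm A)
      ∘ ((fstm X Y ∘ f) ⊗₁ idm A) ∘ copy A.

Definition has_conditionals : Prop :=
  forall A X Y (f : hom A (X ⊗ Y)), exists p : hom (X ⊗ A) Y, is_conditional f p.

Definition as_eq A X Y (h : hom A X) (f g : hom X Y) : Prop :=
  (idm X ⊗₁ f) ∘ copy X ∘ h = (idm X ⊗₁ g) ∘ copy X ∘ h.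

Definition sufficient_fst Theta X Y (h : hom Theta (X ⊗ Y)) : Prop :=
  exists alpha : hom X (X ⊗ Y),
    assoc X X Y ∘ (copy X ⊗₁ idm Y) ∘ h
    = (idm X ⊗₁ alpha) ∘ copy X ∘ fstm X Y ∘ h.

(* The conditional of a joint state with respect to its first factor, read as a
   morphism X -> Y along X ≅ X ⊗ I, is m-a.s. equal to f.  When the X-marginal
   of phi is m, conditionals are unique m-a.s., so it does not matter which one
   is taken. *)
Definition conditional_as_eq X Y (m : hom munit X) (phi : hom munit (X ⊗ Y))
    (f : hom X Y) : Prop :=
  exists p : hom (X ⊗ munit) Y, is_conditional phi p /\ as_eq m (p ∘ runiti X) f.

(* Triple tensor products are bracketed to the left. *)
Definition marg1 Theta X Y (mu : hom munit ((Theta ⊗ X) ⊗ Y)) : hom munit Theta :=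
  runit Theta ∘ runit (Theta ⊗ munit) ∘ ((idm Theta ⊗₁ del X) ⊗₁ del Y) ∘ mu.

Definition marg12 Theta X Y (mu : hom munit ((Theta ⊗ X) ⊗ Y)) : hom munit (Theta ⊗ X) :=
  runit (Theta ⊗ X) ∘ ((idm Theta ⊗₁ idm X) ⊗₁ del Y) ∘ mu.

Definition marg13 Theta X Y (mu : hom munit ((Theta ⊗ X) ⊗ Y)) : hom munit (Theta ⊗ Y) :=
  (runit Theta ⊗₁ idm Y) ∘ ((idm Theta ⊗₁ del X) ⊗₁ idm Y) ∘ mu.

Definition cond_indep Theta X Y (mu : hom munit ((Theta ⊗ X) ⊗ Y)) : Prop :=
  exists (n : hom munit X) (k : hom X Theta) (c : hom X Y),
    mu = ((k ⊗₁ idm X) ⊗₁ c) ∘ (copy X ⊗₁ idm X) ∘ copy X ∘ n.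

Definition as_more_informative Theta X Y
    (m : hom munit Theta) (f : hom Theta X) (g : hom Theta Y) : Prop :=
  exists c : hom X Y, as_eq m (c ∘ f) g.

Definition joint_with_sufficient_fst Theta X Y
    (m : hom munit Theta) (f : hom Theta X) (g : hom Theta Y) : Prop :=
  exists h : hom Theta (X ⊗ Y),
    as_eq m (fstm X Y ∘ h) f /\
    as_eq m (sndm X Y ∘ h) g /\
    deterministic (fstm X Y) /\
    sufficient_fst h.

Definition joint_state_cond_indep Theta X Y
    (m : hom munit Theta) (f : hom Theta X) (g : hom Theta Y) : Prop :=
  exists mu : hom munit ((Theta ⊗ X) ⊗ Y),
    marg1 mu = m /\
    cond_indep mu /\
    conditional_as_eq m (marg12 mu) f /\
    conditional_as_eq m (marg13 mu) g.

End Notions.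

(* Main.v *)
(** All three conditions express a factorisation through one channel
    [c : X -> Y].  From [c] one gets the joint morphism "apply [f], copy, apply
    [c] to one copy"; conversely [c] is recovered from a sufficiency witness
    [alpha] as its [Y]-marginal, because discarding the first copy of [X] in the
    sufficiency equation yields [h = alpha ∘ fst ∘ h].  Conditionals are needed
    only to reach (iii): the Bayesian inverse [k] of [f] with respect to [m]
    turns the joint state of [Theta], [X] and [Y] into the form
    [(k ⊗ id ⊗ c) ∘ copy3 ∘ n] with [n = f ∘ m].  Graph-shaped states
    [(id ⊗ f) ∘ copy ∘ m] determine [f] up to [m]-a.s. equality, which
    translates (c) and (d) into equations between states. *)
From Corelib Require Import ssreflect ssrfun.
Require Import Defs.
Set Implicit Arguments.
Unset Strict Implicit.
Local Open Scope markov_scope.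

Section Category.
Context {C : category}.
Implicit Types A B D E : C.

Lemma comp_eql A B D E (f : hom D E) (g : hom B D) (h : hom A B) (k : hom A D) :
  g ∘ h = k -> f ∘ g ∘ h = f ∘ k.
Proof. by move=> <-; rewrite comp_assoc. Qed.

Lemma split_epi_cancel A B D (e : hom A B) (e' : hom B A) (f g : hom B D) :
  e ∘ e' = idm B -> f ∘ e = g ∘ e -> f = g.
Proof.
by move=> ee' fg; rewrite -(comp_idr f) -(comp_idr g) -ee' !comp_assoc fg.
Qed.

Lemma split_mono_cancel A B D (e : hom B D) (e' : hom D B) (f g : hom A B) :
  e' ∘ e = idm B -> e ∘ f = e ∘ g -> f = g.
Proof.
by move=> ee' fg; rewrite -(comp_idl f) -(comp_idl g) -ee' -!comp_assoc fg.
Qed.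
End Category.

(** * Coherence of the unit with associativity and symmetry *)

Section SymmetricMonoidal.
Context {C : symMonCategory}.
Implicit Types A B D E : C.

Lemma tensm_compl A A' A'' B (f' : hom A' A'') (f : hom A A') :
  (f' ∘ f) ⊗₁ idm B = (f' ⊗₁ idm B) ∘ (f ⊗₁ idm B).
Proof. by rewrite -tensm_comp comp_idl. Qed.

Lemma tensm_compr A B B' B'' (f' : hom B' B'') (f : hom B B') :
  idm A ⊗₁ (f' ∘ f) = (idm A ⊗₁ f') ∘ (idm A ⊗₁ f).
Proof. by rewrite -tensm_comp comp_idl. Qed.

Lemma tens_munitl_faithful A B (f g : hom A B) :
  idm munit ⊗₁ f = idm munit ⊗₁ g -> f = g.
Proof.
by move=> e; apply: (split_epi_cancel (lunitiK A)); rewrite -!lunit_nat e.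
Qed.

Lemma tens_munitr_faithful A B (f g : hom A B) :
  f ⊗₁ idm munit = g ⊗₁ idm munit -> f = g.
Proof.
by move=> e; apply: (split_epi_cancel (runitiK A)); rewrite -!runit_nat e.
Qed.

Lemma assoc_tensl_epi A B D E F (f g : hom ((A ⊗ (B ⊗ D)) ⊗ E) F) :
  f ∘ (assoc A B D ⊗₁ idm E) = g ∘ (assoc A B D ⊗₁ idm E) -> f = g.
Proof.
apply: (split_epi_cancel (e' := associ A B D ⊗₁ idm E)).
by rewrite -tensm_compl associK tensm_id.
Qed.

(* Kelly's argument: after tensoring with the unit, both sides can be read off
   the pentagon at [munit, munit, A, B] by the triangle. *)
Lemma lunit_assoc A B : lunit (A ⊗ B) ∘ assoc munit A B = lunit A ⊗₁ idm B.
Proof.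
apply: tens_munitl_faithful.
apply: (split_epi_cancel (associK munit (munit ⊗ A) B)).
apply: assoc_tensl_epi.
rewrite tensm_compr -!comp_assoc (comp_assoc (idm _ ⊗₁ assoc _ _ _)) -pentagon.
rewrite comp_assoc triangle -(tensm_id A B) -assoc_nat -triangle tensm_compl.
by rewrite !comp_assoc assoc_nat.
Qed.

(** Mirror image of [lunit_assoc], from the pentagon at [A, B, munit, munit]. *)
Lemma runit_assoc A B : (idm A ⊗₁ runit B) ∘ assoc A B munit = runit (A ⊗ B).
Proof.
apply: tens_munitr_faithful.
apply: (split_mono_cancel (assocK A B munit)).
rewrite -triangle tensm_compl !comp_assoc assoc_nat -triangle tensm_compr.
rewrite -!comp_assoc (comp_assoc (idm _ ⊗₁ assoc _ _ _)) -pentagon.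
by rewrite comp_assoc -(tensm_id A B) !comp_assoc assoc_nat.
Qed.

(** The hexagon at [A, munit, munit], followed by [lunit], yields this identity tensored with
    [munit] and followed by an invertible swap. *)
Lemma lunit_swap A : lunit A ∘ swap A munit = runit A.
Proof.
apply: tens_munitr_faithful.
apply: (split_mono_cancel (swapK A munit)).
rewrite tensm_compl -lunit_assoc -triangle !comp_assoc.
rewrite -lunit_nat (swap_nat (idm A)) -lunit_assoc.
have := f_equal (fun f => lunit _ ∘ f) (hexagon A munit munit).
by rewrite !comp_assoc => ->.
Qed.

Lemma runiti_nat A B (f : hom A B) : runiti B ∘ f = (f ⊗₁ idm munit) ∘ runiti A.
Proof.
apply: (split_mono_cancel (runitK B)).
by rewrite !comp_assoc runitiK runit_nat -comp_assoc runitiK comp_idl comp_idr.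
Qed.

Lemma assoc_runiti A B : assoc A B munit ∘ runiti (A ⊗ B) = idm A ⊗₁ runiti B.
Proof.
apply: (split_mono_cancel (e := idm A ⊗₁ runit B) (e' := idm A ⊗₁ runiti B)).
  by rewrite -tensm_compr runitK tensm_id.
by rewrite comp_assoc runit_assoc -tensm_compr !runitiK tensm_id.
Qed.
End SymmetricMonoidal.

(** * Projections and copying *)

Section Markov.
Context {C : markovCategory}.
Implicit Types A B D E X Y Z Theta : C.

Lemma fstm_nat A A' B B' (f : hom A A') (g : hom B B') :
  fstm A' B' ∘ (f ⊗₁ g) = f ∘ fstm A B.
Proof.
rewrite /fstm -!comp_assoc -tensm_comp comp_idl (del_unique (del B' ∘ g)).
by rewrite comp_assoc -runit_nat -comp_assoc -tensm_comp comp_idr comp_idl.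
Qed.

Lemma sndm_nat A A' B B' (f : hom A A') (g : hom B B') :
  sndm A' B' ∘ (f ⊗₁ g) = g ∘ sndm A B.
Proof.
rewrite /sndm -!comp_assoc -tensm_comp comp_idl (del_unique (del A' ∘ f)).
by rewrite comp_assoc -lunit_nat -comp_assoc -tensm_comp comp_idr comp_idl.
Qed.

Lemma fstm_copy X : fstm X X ∘ copy X = idm X.
Proof. exact: copy_counitr. Qed.

Lemma sndm_copy X : sndm X X ∘ copy X = idm X.
Proof. exact: copy_counitl. Qed.

Lemma fstm_pair A X Y Z (h : hom A Z) (f : hom Z X) (g : hom Z Y) :
  fstm X Y ∘ ((f ⊗₁ g) ∘ copy Z ∘ h) = f ∘ h.
Proof. by rewrite !comp_assoc fstm_nat -(comp_assoc f) fstm_copy comp_idr. Qed.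

Lemma sndm_pair A X Y Z (h : hom A Z) (f : hom Z X) (g : hom Z Y) :
  sndm X Y ∘ ((f ⊗₁ g) ∘ copy Z ∘ h) = g ∘ h.
Proof. by rewrite !comp_assoc sndm_nat -(comp_assoc g) sndm_copy comp_idr. Qed.

Lemma sndm_swap A B : sndm B A ∘ swap A B = fstm A B.
Proof. by rewrite /sndm -comp_assoc -swap_nat comp_assoc lunit_swap. Qed.

Lemma sndm_assoc A B D : sndm A (B ⊗ D) ∘ assoc A B D = sndm A B ⊗₁ idm D.
Proof.
rewrite /sndm -tensm_id -comp_assoc -assoc_nat comp_assoc lunit_assoc.
by rewrite -tensm_compl.
Qed.

Lemma fstm_associ A B D :
  (fstm A B ⊗₁ idm D) ∘ associ A B D = idm A ⊗₁ sndm B D.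
Proof.
apply: (split_epi_cancel (associK A B D)).
rewrite -comp_assoc assocK comp_idr /fstm /sndm tensm_compl tensm_compr.
by rewrite -comp_assoc -assoc_nat comp_assoc triangle.
Qed.

Lemma fstm_assoc A B D : (idm A ⊗₁ fstm B D) ∘ assoc A B D = fstm (A ⊗ B) D.
Proof.
rewrite /fstm tensm_compr -comp_assoc -assoc_nat comp_assoc runit_assoc.
by rewrite tensm_id.
Qed.

(** Terminality forces [del munit] to be the identity, so the counit law makes [copy munit] a right
    inverse of [runit munit]. *)
Lemma copy_munit : copy (@munit C) = runiti munit.
Proof.
apply: (split_mono_cancel (runitK munit)); rewrite runitiK -fstm_copy /fstm.
by rewrite -(del_unique (idm munit)) tensm_id comp_idr.
Qed.

Lemma fstm_middle_swap A B D E :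
  (fstm A D ⊗₁ fstm B E) ∘ middle_swap A B D E = fstm (A ⊗ B) (D ⊗ E).
Proof.
(* Only the strands other than [A] matter here: the swap turns the projection [sndm D B] into
   [fstm B D]. *)
have inner : fstm B E ∘ (sndm D (B ⊗ E)
    ∘ (assoc D B E ∘ (swap B D ⊗₁ idm E) ∘ associ B D E)) = fstm B (D ⊗ E).
  have := sndm_assoc D B E; move: (sndm D (B ⊗ E)) => s sE.
  rewrite (comp_assoc s) (comp_assoc s) sE -tensm_compl sndm_swap fstm_associ.
  by rewrite fstm_nat comp_idl.
rewrite -fstm_assoc -inner.
have -> : fstm A D ⊗₁ fstm B E
    = (idm A ⊗₁ fstm B E) ∘ (fstm A D ⊗₁ idm (B ⊗ E)).
  by rewrite -tensm_comp comp_idl comp_idr.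
have e := fstm_associ A D (B ⊗ E); move: (sndm D (B ⊗ E)) e => s e.
move: (fstm A D) (fstm B E) e => p q e.
rewrite /middle_swap !comp_assoc (comp_eql _ e).
by rewrite -!tensm_compr !comp_assoc.
Qed.

(** By [copy_tens], projecting both copies of [X ⊗ Y] discards both copies of [Y] and leaves
    [copy X]. *)
Lemma fstm_deterministic X Y : deterministic (fstm X Y).
Proof.
rewrite /deterministic copy_tens comp_assoc fstm_middle_swap.
by rewrite fstm_nat.
Qed.

Lemma as_eq_postcomp A X Y Z (h : hom A X) (f g : hom X Y) (c : hom Y Z) :
  as_eq h f g -> as_eq h (c ∘ f) (c ∘ g).
Proof.
rewrite /as_eq !tensm_compr -!comp_assoc => fg.
by congr (_ ∘ _).
Qed.

(** For a state, the extra input [munit] is carried along by [runiti], whose naturality moves it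
    next to [p]. *)
Lemma is_conditional_state X Y (phi : hom munit (X ⊗ Y)) (p : hom (X ⊗ munit) Y) :
  is_conditional phi p <->
  phi = (idm X ⊗₁ (p ∘ runiti X)) ∘ copy X ∘ (fstm X Y ∘ phi).
Proof.
rewrite /is_conditional copy_munit; move: (fstm X Y ∘ phi) => s.
rewrite -(comp_assoc _ (s ⊗₁ _)) -runiti_nat comp_assoc.
rewrite -(comp_assoc _ (copy X ⊗₁ _)) -runiti_nat comp_assoc.
by rewrite -(comp_assoc _ (assoc _ _ _)) assoc_runiti -tensm_compr.
Qed.

Lemma conditional_as_eqP X Y (m : hom munit X) (phi : hom munit (X ⊗ Y))
    (f : hom X Y) :
  fstm X Y ∘ phi = m ->
  conditional_as_eq m phi f <-> phi = (idm X ⊗₁ f) ∘ copy X ∘ m.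
Proof.
move=> phi_m; split=> [[p [/is_conditional_state phiE <-]]|phiE].
  by rewrite phi_m in phiE.
have fK : f ∘ runit X ∘ runiti X = f by rewrite -comp_assoc runitiK comp_idr.
(* A graph-shaped state has [f] itself as conditional, once the unit input is absorbed. *)
exists (f ∘ runit X); split; last by rewrite fK.
by apply/is_conditional_state; rewrite fK phi_m.
Qed.

(** * Sufficient statistics: (i) and (ii) *)

Lemma more_informative_joint Theta X Y (m : hom munit Theta)
    (f : hom Theta X) (g : hom Theta Y) :
  as_more_informative m f g -> joint_with_sufficient_fst m f g.
Proof.
case=> c cf_g; exists ((idm X ⊗₁ c) ∘ copy X ∘ f).
have fst_h : fstm X Y ∘ ((idm X ⊗₁ c) ∘ copy X ∘ f) = f.
  by rewrite fstm_pair comp_idl.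
rewrite fst_h sndm_pair; split=> //; split=> //.
split; first exact: fstm_deterministic.
(* Regenerating [Y] from [X] through [c] witnesses sufficiency, by coassociativity of copying. *)
exists ((idm X ⊗₁ c) ∘ copy X).
rewrite -(comp_assoc _ (fstm X Y)) fst_h !comp_assoc; congr (_ ∘ _).
rewrite tensm_compr -(comp_assoc (idm X ⊗₁ (idm X ⊗₁ c))) -copy_coassoc.
rewrite !comp_assoc -assoc_nat tensm_id; congr (_ ∘ _).
by rewrite -!(comp_assoc (assoc X X Y)) -!tensm_comp !comp_idl !comp_idr.
Qed.

(* Discard the first copy of [X]. *)
Lemma copy_fst_factor A X Y (h : hom A (X ⊗ Y)) (alpha : hom X (X ⊗ Y))
    (p : hom A X) :
  assoc X X Y ∘ (copy X ⊗₁ idm Y) ∘ h = (idm X ⊗₁ alpha) ∘ copy X ∘ p ->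
  h = alpha ∘ p.
Proof.
move/(f_equal (comp (sndm X (X ⊗ Y)))).
rewrite !comp_assoc sndm_assoc -tensm_compl sndm_copy tensm_id comp_idl.
by rewrite sndm_nat -(comp_assoc alpha) sndm_copy comp_idr.
Qed.

Lemma joint_more_informative Theta X Y (m : hom munit Theta)
    (f : hom Theta X) (g : hom Theta Y) :
  joint_with_sufficient_fst m f g -> as_more_informative m f g.
Proof.
case=> h [fst_h [snd_h [_ [alpha]]]].
rewrite -(comp_assoc _ (fstm X Y)) => /copy_fst_factor hE.
(* Since [h] factors through its own [X]-marginal, that marginal may be replaced by [f] almost
   surely. *)
exists (sndm X Y ∘ alpha); rewrite /as_eq -snd_h.
by rewrite hE (comp_assoc _ alpha); apply: esym (as_eq_postcomp _ fst_h).
Qed.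

(** * Conditional independence: (i) and (iii) *)

Lemma marg12E Theta X Y (mu : hom munit ((Theta ⊗ X) ⊗ Y)) :
  marg12 mu = fstm (Theta ⊗ X) Y ∘ mu.
Proof. by rewrite /marg12 tensm_id. Qed.

Lemma marg1E Theta X Y (mu : hom munit ((Theta ⊗ X) ⊗ Y)) :
  marg1 mu = fstm Theta X ∘ marg12 mu.
Proof.
rewrite /marg1 marg12E /fstm !comp_assoc; congr (_ ∘ _).
rewrite -(comp_assoc _ (idm Theta ⊗₁ del X)) -(runit_nat (idm Theta ⊗₁ del X)).
rewrite -!comp_assoc.
by rewrite -tensm_comp comp_idl comp_idr.
Qed.

Lemma marg13E Theta X Y (mu : hom munit ((Theta ⊗ X) ⊗ Y)) :
  marg13 mu = (fstm Theta X ⊗₁ idm Y) ∘ mu.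
Proof. by rewrite /marg13 -tensm_compl. Qed.

Section ConditionalIndependence.
Context {Theta X Y : C} (n : hom munit X) (k : hom X Theta) (c : hom X Y).

Let mu := ((k ⊗₁ idm X) ⊗₁ c) ∘ (copy X ⊗₁ idm X) ∘ copy X ∘ n.

Lemma marg12_cond_indep : marg12 mu = (k ⊗₁ idm X) ∘ copy X ∘ n.
Proof.
rewrite marg12E /mu !comp_assoc fstm_nat -(comp_assoc _ (fstm _ _)) fstm_nat.
by rewrite comp_assoc -(comp_assoc _ (fstm X X)) fstm_copy comp_idr.
Qed.

Lemma marg1_cond_indep : marg1 mu = k ∘ n.
Proof. by rewrite marg1E marg12_cond_indep fstm_pair. Qed.

Lemma marg13_cond_indep : marg13 mu = (k ⊗₁ c) ∘ copy X ∘ n.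
Proof.
rewrite marg13E /mu !comp_assoc -!tensm_comp comp_idl comp_idr fstm_nat.
by rewrite -(comp_assoc k) fstm_copy comp_idr.
Qed.

End ConditionalIndependence.

(** Bayesian inversion: [k] is a conditional, with respect to [X], of the joint state with [X]
    placed first; commutativity of copying allows swapping back. *)
Lemma state_disintegration (C_cond : has_conditionals C) A X
    (m : hom munit A) (f : hom A X) :
  exists k : hom X A, (idm A ⊗₁ f) ∘ copy A ∘ m = (k ⊗₁ idm X) ∘ copy X ∘ (f ∘ m).
Proof.
have [p /is_conditional_state] := C_cond _ _ _ ((f ⊗₁ idm A) ∘ copy A ∘ m).
rewrite fstm_pair; move/(f_equal (comp (swap X A))).
rewrite !comp_assoc !swap_nat -!(comp_assoc _ (swap _ _)) !copy_comm => mE.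
by exists (p ∘ runiti X); rewrite mE !comp_assoc.
Qed.

Lemma more_informative_cond_indep Theta X Y (m : hom munit Theta)
    (f : hom Theta X) (g : hom Theta Y) (C_cond : has_conditionals C) :
  as_more_informative m f g -> joint_state_cond_indep m f g.
Proof.
case=> c cf_g; have [k fE] := state_disintegration C_cond m f.
(* Applying [c] to the [X] component of [fE] gives the joint state of [Theta] and [Y]. *)
have gE : (idm Theta ⊗₁ g) ∘ copy Theta ∘ m = (k ⊗₁ c) ∘ copy X ∘ (f ∘ m).
  rewrite -cf_g tensm_compr -!comp_assoc (comp_assoc _ (copy Theta)) fE.
  by rewrite !comp_assoc -tensm_comp comp_idl comp_idr.
have fstm_graph Z (q : hom Theta Z) :
    fstm Theta Z ∘ ((idm Theta ⊗₁ q) ∘ copy Theta ∘ m) = m.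
  by rewrite fstm_pair comp_idl.
exists (((k ⊗₁ idm X) ⊗₁ c) ∘ (copy X ⊗₁ idm X) ∘ copy X ∘ (f ∘ m)).
split; first by rewrite marg1E marg12_cond_indep -fE fstm_graph.
split; first by exists (f ∘ m), k, c.
rewrite marg12_cond_indep marg13_cond_indep -fE -gE.
by split; apply/conditional_as_eqP.
Qed.

Lemma cond_indep_more_informative Theta X Y (m : hom munit Theta)
    (f : hom Theta X) (g : hom Theta Y) :
  joint_state_cond_indep m f g -> as_more_informative m f g.
Proof.
case=> mu [mu_m [[n [k [c muE]]] []]].
move: mu_m; rewrite muE marg1_cond_indep marg12_cond_indep marg13_cond_indep => kn.
(* Both two-variable marginals have [Theta]-marginal [k ∘ n], which is [m], so (c) and (d) become
   equations of states. *)
move=> /(conditional_as_eqP _ (etrans (fstm_pair _ _ _) kn)) fE.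
move=> /(conditional_as_eqP _ (etrans (fstm_pair _ _ _) kn)) gE.
(* The [Theta], [Y] marginal arises from the [Theta], [X] marginal by applying [c] to the second
   component. *)
exists c; rewrite /as_eq -gE tensm_compr -!comp_assoc.
rewrite (comp_assoc _ (copy Theta)) -fE.
by rewrite !comp_assoc -tensm_comp comp_idl comp_idr.
Qed.
End Markov.

Theorem theorem5p4 (C : markovCategory) (Theta X Y : C)
    (m : hom munit Theta) (f : hom Theta X) (g : hom Theta Y) :
  has_conditionals C ->
  (as_more_informative m f g <-> joint_with_sufficient_fst m f g) /\
  (joint_with_sufficient_fst m f g <-> joint_state_cond_indep m f g).
Proof.
move=> C_cond; split; split.
- exact: more_informative_joint.
- exact: joint_more_informative.
- by move/joint_more_informative; apply: more_informative_cond_indep.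
- by move/cond_indep_more_informative; apply: more_informative_joint.
Qed.
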